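(* For every integer $n\ge1$, $$\mu_n(1+x+y)=\frac1\pi\left\{\mathrm{Ls}_{n+1}\!\left(\frac\pi3\right)-\mathrm{Ls}_{n+1}(\pi)\right\}+\frac2\pi\int_0^{\pi/6}\rho_n(2\sin\theta)\,d\theta+\frac2\pi\sum_{k=2}^n\binom nk\int_{\pi/6}^{\pi/2}\log^{n-k}(2\sin\theta)\,\rho_k\!\left(\frac1{2\sin\theta}\right)d\theta .$$
   Context: The higher Mahler measure is $\mu_n(1+x+y)=\int_0^1\int_0^1\left(\log\left|1+e^{2\pi i t}+e^{2\pi i u}\right|\right)^n dt\,du$. The log-sine integrals are $\mathrm{Ls}_{n}(\sigma)=-\int_0^\sigma \log^{n-1}\left|2\sin\frac\theta2\right|d\theta$. For real $\alpha$ and integer $n\ge0$, $\rho_n(\alpha)=\frac1{2\pi}\int_{-\pi}^{\pi}\left(\mathrm{Re}\,\log(1-\alpha e^{i\omega})\right)^n d\omega$, where $\mathrm{Re}\log(z)=\log|z|$. *)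

(* Defs.v *)
From HB Require Import structures.
From mathcomp Require Import all_boot all_order all_algebra.
From mathcomp Require Import all_classical all_reals all_analysis.
From mathcomp Require Import complex.

Set Implicit Arguments.
Unset Strict Implicit.
Unset Printing Implicit Defensive.

Import Order.TTheory GRing.Theory Num.Theory.
Import numFieldNormedType.Exports.

Local Open Scope classical_set_scope.
Local Open Scope ring_scope.

(* All integrals are real-valued Lebesgue integrals.  The integrands below have
   at most logarithmic singularities, so all these integrals converge; the
   convention [ln 0 = 0] only matters on null sets. *)

(* The point e^{it} of the unit circle. *)
Definition expi (R : realType) (t : R) : R[i] := (cos t +i* sin t)%C.

(* Re log z = log |z|.  The modulus is taken through [ComplexField.Normc.normc],
   which has values in [R], whereas [`|z|] has values in [R[i]]. *)
Definition Relog (R : realType) (z : R[i]) : R := ln (ComplexField.Normc.normc z).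

(* mu_n(1 + x + y), with t as the inner variable. *)
Definition mahler_1xy (R : realType) (n : nat) : R :=
  \int[lebesgue_measure]_(u in `[0, 1])
    \int[lebesgue_measure]_(t in `[0, 1])
      Relog (1 + expi (2 * pi * t) + expi (2 * pi * u)) ^+ n.

(* Ls_n(sigma), for n >= 1 and sigma >= 0: the integral is over the set
   [0, sigma] and is not oriented. *)
Definition Ls (R : realType) (n : nat) (sigma : R) : R :=
  - \int[lebesgue_measure]_(theta in `[0, sigma])
      ln `|2 * sin (theta / 2)| ^+ n.-1.

Definition rho (R : realType) (n : nat) (alpha : R) : R :=
  (2 * pi)^-1 *
  \int[lebesgue_measure]_(omega in `[- pi, pi])
    Relog (1 - alpha%:C%C * expi omega) ^+ n.

(* Main.v *)
(* Rotating the unit circle turns the inner integral of mu_n into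
   rho_n(2 cos(pi u)), so mu_n is 2/pi times the integral of
   rho_n(2 sin theta) over [0, pi/2]; on ]pi/6, pi/2], where
   alpha = 2 sin theta > 1, the identity
   log|1 - alpha e^{iw}| = log alpha + log|1 - alpha^{-1} e^{iw}| is raised to
   the n-th power.  In the binomial expansion rho_0 = 1 yields the log-sine
   integrals, and rho_1 vanishes on [0, 1[: the factorisation
   1 - z^2 = (1 - z)(1 + z) gives 2 rho_1(b) = rho_1(b^2), while rho_1 is
   bounded.  All integrability follows from the bound
   |1 - a e^{iw}| >= |w| / 4 for a >= 0 and |w| <= pi, since every power of the
   logarithm is then O(|w|^{-1/2}), uniformly in 0 <= a <= 2. *)
Require Import Defs.
From HB Require Import structures.
From mathcomp Require Import all_boot all_order all_algebra.
From mathcomp Require Import all_classical all_reals all_analysis.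
From mathcomp Require Import measurable_realfun complex.
From mathcomp Require Import ring lra.

Import Order.TTheory GRing.Theory Num.Theory.
Import numFieldNormedType.Exports.

Local Open Scope classical_set_scope.
Local Open Scope ring_scope.

(** * Affine change of variables for the Lebesgue integral *)

Section affine.
Set Implicit Arguments.
Unset Strict Implicit.
Context {R : realType}.
Notation mu := (@lebesgue_measure R).
Implicit Types (D : set R) (f : R -> R).

Lemma measurable_affine (a b : R) :
  measurable_fun [set: R] (fun x : R => a * x + b).
Proof. by apply: measurable_funD => //; exact: measurable_funM. Qed.

(** Half-open intervals determine Lebesgue measure. For negative [a] the preimage is closed on the
    other side, which does not affect its length. *)
Lemma affine_preimage_itv_measure (a b x y : R) : a != 0 ->
  (`|a|%:E * mu ((fun t : R => a * t + b)%R @^-1` `]x, y]) = mu `]x, y])%E.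
Proof.
move=> a0; have [yx|xy] := leP y x.
  by rewrite set_itv_ge ?bnd_simp -?leNgt// preimage_set0 !measure0 mule0.
have [an|ap] := ltP a 0.
  have -> : (fun t : R => a * t + b) @^-1` `]x, y] = `[(y - b) / a, (x - b) / a[%classic.
    apply/seteqP; split=> t /=; rewrite !in_itv/= => /andP[h1 h2]; apply/andP; split.
    - by rewrite ler_ndivrMr//; lra.
    - by rewrite ltr_ndivlMr//; lra.
    - by move: h2; rewrite ltr_ndivlMr//; lra.
    - by move: h1; rewrite ler_ndivrMr//; lra.
  rewrite !lebesgue_measure_itv/= !lte_fin xy ltr_nM2r ?invr_lt0// ltrD2r xy.
  by rewrite ltr0_norm// -!EFinD -EFinM; congr EFin; field.
have {}ap : 0 < a by rewrite lt_neqAle eq_sym a0.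
have -> : (fun t : R => a * t + b) @^-1` `]x, y] = `](x - b) / a, (y - b) / a]%classic.
  apply/seteqP; split=> t /=; rewrite !in_itv/= => /andP[h1 h2]; apply/andP; split.
  - by rewrite ltr_pdivrMr//; lra.
  - by rewrite ler_pdivlMr//; lra.
  - by move: h1; rewrite ltr_pdivrMr//; lra.
  - by move: h2; rewrite ler_pdivlMr//; lra.
rewrite !lebesgue_measure_itv/= !lte_fin xy ltr_pM2r ?invr_gt0// ltrD2r xy.
by rewrite gtr0_norm// -!EFinD -EFinM; congr EFin; field.
Qed.

(** The pushforward of [mu] under the affine map, scaled by [|a|], agrees with [mu] on half-open
    intervals, hence is [mu] by uniqueness. *)
Lemma ge0_integral_affine (a b : R) D (f : R -> \bar R) : a != 0 ->
  measurable D -> measurable_fun [set: R] f -> (forall x, 0 <= f x)%E ->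
  (\int[mu]_(x in D) f x =
   `|a|%:E * \int[mu]_(x in (fun t => a * t + b)%R @^-1` D) f (a * x + b)%R)%E.
Proof.
move=> a0 mD mf f0.
pose phi : measurableTypeR R -> measurableTypeR R := fun x : R => a * x + b.
have mphi : measurable_fun [set: measurableTypeR R] phi by exact: measurable_affine.
pose nu := measure_function_pushforward__canonical__measure_function_Measure
  mu mphi.
pose k := NngNum (normr_ge0 a).
have nuE A : measurable A -> mu A = mscale k nu A.
  move=> mA; apply: lebesgue_measure_unique => // _ [[x y] _ <-].
  exact/esym/affine_preimage_itv_measure.
transitivity (\int[mscale k nu]_(x in D) f x)%E.
  by apply: eq_measure_integral => A mA _; exact: nuE.
rewrite ge0_integral_mscale//; last exact: measurable_funTS.
by rewrite /nu ge0_integral_pushforward//; exact: measurable_funTS.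
Qed.

Lemma Rintegral_affine (a b : R) D f : a != 0 ->
  measurable D -> measurable_fun [set: R] f ->
  \int[mu]_(x in D) f x =
  `|a| * \int[mu]_(x in (fun t => a * t + b) @^-1` D) f (a * x + b).
Proof.
move=> a0 mD mf; rewrite /Rintegral.
have mEf : measurable_fun [set: R] (EFin \o f) by exact/measurable_EFinP.
rewrite [in LHS]integralE [in RHS]integralE.
rewrite (ge0_integral_affine b a0 mD) //; last exact: measurable_funepos.
rewrite (ge0_integral_affine b a0 mD (measurable_funeneg mEf)) //.
rewrite -[`|a| in RHS]/(fine `|a|%:E).
have pE : (fun x => ((f (a * x + b)%R)%:E))^\+%E =
    (fun x => (EFin \o f)^\+%E (a * x + b)) :> (R -> \bar R).
  by apply/funext => x; rewrite !funeposE.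
have nE : (fun x => ((f (a * x + b)%R)%:E))^\-%E =
    (fun x => (EFin \o f)^\-%E (a * x + b)) :> (R -> \bar R).
  by apply/funext => x; rewrite !funenegE.
rewrite pE nE.
set p := integral _ _ _; set q := integral _ _ _.
have p0 : (0 <= p)%E by exact: integral_ge0.
have q0 : (0 <= q)%E by exact: integral_ge0.
have ap : 0 < `|a| by rewrite normr_gt0.
(* No integrability is assumed: if either part is infinite, [fine] sends both sides to 0. *)
case: p p0 => [p| |]; case: q q0 => [q| |]//= _ _.
- by rewrite -mulrBr.
- by rewrite gt0_muley ?lte_fin//= mulr0.
- by rewrite gt0_muley ?lte_fin//= mulr0.
- by rewrite gt0_muley ?lte_fin//= mulr0.
Qed.
End affine.

(** * The kernel log |1 - a e^{iw}| and its identities *)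

Section logdist.
Set Implicit Arguments.
Unset Strict Implicit.
Context {R : realType}.
Notation mu := (@lebesgue_measure R).
Implicit Types (a b w x y : R).

Lemma ln_sqrt x : ln (Num.sqrt x) = ln x / 2.
Proof.
have [x0|x0] := leP x 0; first by rewrite ler0_sqrtr// !ln0// mul0r.
rewrite -{2}(sqr_sqrtr (ltW x0)) lnXn ?sqrtr_gt0//.
by rewrite -mulr_natr; field.
Qed.

(* [log |1 - a e^{iw}|], computed from the squared modulus *)
Definition logdist a w : R := ln (1 + a ^+ 2 - 2 * a * cos w) / 2.

Lemma logdist_arg a w :
  1 + a ^+ 2 - 2 * a * cos w = (a - cos w) ^+ 2 + sin w ^+ 2.
Proof. by rewrite sin2cos2; ring. Qed.

Lemma Relog_logdist a w : Relog (1 - a%:C%C * expi w) = logdist a w.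
Proof.
rewrite /Relog /expi /=; simpc; rewrite /= ln_sqrt /logdist.
congr (ln _ / _).
transitivity (1 - 2 * a * cos w + a ^+ 2 * (cos w ^+ 2 + sin w ^+ 2)); first by ring.
by rewrite cos2Dsin2; ring.
Qed.

(** Since 1 + e^{2iv} = 2 cos v e^{iv}, the modulus is that of 1 + 2 cos v e^{i(s - v)}, up to
    conjugation; adding pi to the angle restores the minus sign. *)
Lemma Relog_sum_expi (s v : R) :
  Relog (1 + expi s + expi (v + v)) = logdist (2 * cos v) (s + (pi - v)).
Proof.
rewrite /Relog /expi /=; simpc; rewrite /= ln_sqrt /logdist.
congr (ln _ / _); rewrite [s + _]addrCA addrC cosDpi cosB cosD sinD.
transitivity (1 + (cos s ^+ 2 + sin s ^+ 2) + (cos v ^+ 2 + sin v ^+ 2) ^+ 2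
  + 2 * cos s * (1 + cos v ^+ 2 - sin v ^+ 2) + 2 * (cos v ^+ 2 - sin v ^+ 2)
  + 4 * sin v * cos v * sin s); first by ring.
by rewrite !cos2Dsin2 sin2cos2; ring.
Qed.

Lemma rhoE n a :
  rho n a = (2 * pi)^-1 * \int[mu]_(w in `[- pi, pi]) logdist a w ^+ n.
Proof.
by rewrite /rho; congr (_ * _); apply: eq_Rintegral => w _; rewrite Relog_logdist.
Qed.

Lemma logdistD2pi a w : logdist a (w + 2 * pi) = logdist a w.
Proof. by rewrite /logdist [2 * pi]mulr_natl cosD2pi. Qed.

Lemma logdistDpi a w : logdist a (w + pi) = logdist (- a) w.
Proof. by rewrite /logdist cosDpi sqrrN; congr (ln _ / _); ring. Qed.

(** This is 1 - z^2 = (1 - z)(1 + z) at z = a e^{iw}; for |a| < 1 both factors are nonzero, so their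
    logarithms add. *)
Lemma logdist_double a w : `|a| < 1 ->
  logdist a w + logdist (- a) w = logdist (a ^+ 2) (2 * w).
Proof.
move=> a1.
have pos b z : `|b| < 1 -> 0 < 1 + b ^+ 2 - 2 * b * cos z.
  move=> b1; apply: (@lt_le_trans _ _ ((1 - `|b|) ^+ 2)).
    by rewrite exprn_gt0// subr_gt0.
  have : b * cos z <= `|b|.
    rewrite (le_trans (ler_norm _))// normrM ler_piMr// cos_max//.
  by rewrite -(real_normK (num_real b)); nra.
have a1' : `|- a| < 1 by rewrite normrN.
rewrite /logdist -mulrDl -lnM ?posrE ?pos//; congr (ln _ / _).
rewrite [2 * w]mulr_natl cos_mulr2n -mulr_natr; ring.
Qed.

(** Factor a e^{iw} out of 1 - a e^{iw}: what remains has the modulus of 1 - a^{-1} e^{-iw}, and the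
    kernel is even in w. *)
Lemma logdist_inv a w : 1 < a -> logdist a w = ln a + logdist a^-1 w.
Proof.
move=> a1; have a0 : 0 < a by lra.
have c1 := cos_le1 w.
have p1 : 0 < 1 + a ^+ 2 - 2 * a * cos w.
  have : 0 < (a - 1) ^+ 2 by rewrite exprn_gt0// subr_gt0.
  nra.
have p2 : 0 < 1 + a^-1 ^+ 2 - 2 * a^-1 * cos w.
  have -> : 1 + a^-1 ^+ 2 - 2 * a^-1 * cos w =
    (1 + a ^+ 2 - 2 * a * cos w) * a^-1 ^+ 2 by field; rewrite gt_eqF.
  by rewrite mulr_gt0// exprn_gt0// invr_gt0.
have -> : ln a = ln (a ^+ 2) / 2 by rewrite lnXn// -mulr_natr; field.
rewrite /logdist -mulrDl -lnM ?posrE ?exprn_gt0//; congr (ln _ / _).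
by field; rewrite gt_eqF.
Qed.

Lemma measurable_cos : measurable_fun [set: R] (@cos R).
Proof. by apply: continuous_measurable_fun; exact: continuous_cos. Qed.

Lemma measurable_sin : measurable_fun [set: R] (@sin R).
Proof. by apply: continuous_measurable_fun; exact: continuous_sin. Qed.

Lemma measurable_logdist2 : measurable_fun [set: R * R] (fun p => logdist p.1 p.2).
Proof.
apply: measurable_funM => //; apply: (measurableT_comp (@measurable_ln R)).
apply: measurable_funB.
  by apply: measurable_funD => //; exact: measurable_funX.
apply: measurable_funM; first exact: measurable_funM.
exact: (measurableT_comp measurable_cos).
Qed.

Lemma measurable_logdist a : measurable_fun [set: R] (logdist a).
Proof.
apply: measurable_funM => //; apply: (measurableT_comp (@measurable_ln R)).
apply: measurable_funB => //; apply: measurable_funM => //.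
exact: measurable_cos.
Qed.

End logdist.

(** * Integrals of periodic functions over one period *)

Section period.
Set Implicit Arguments.
Unset Strict Implicit.
Context {R : realType}.
Notation mu := (@lebesgue_measure R).

Lemma ge0_integral_itv_split (f : R -> \bar R) (a b c : R) :
  measurable_fun [set: R] f -> (forall x, 0 <= f x)%E -> a <= b -> b <= c ->
  (\int[mu]_(x in `]a, c]) f x =
   \int[mu]_(x in `]a, b]) f x + \int[mu]_(x in `]b, c]) f x)%E.
Proof.
move=> mf f0 ab bc.
rewrite (@itv_bndbnd_setU _ _ _ (BRight b)) ?bnd_simp//.
rewrite ge0_integral_setU//; first exact: measurable_funTS.
apply/disj_setPS => x [] /=; rewrite !in_itv/= => /andP[_ xb] /andP[bx _].
by move: xb; rewrite leNgt bx.
Qed.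

(** Cut the shifted window at [c + T]: the part beyond is the translate by [T] of the initial piece
    of length [s] that the shift dropped. *)
Lemma ge0_integral_period (f : R -> \bar R) (T c s : R) :
  measurable_fun [set: R] f -> (forall x, 0 <= f x)%E ->
  (forall x : R, f (x + T) = f x) -> 0 <= s <= T ->
  (\int[mu]_(x in `](c + s)%R, (c + s + T)%R]) f x =
   \int[mu]_(x in `]c, (c + T)%R]) f x)%E.
Proof.
move=> mf f0 fT /andP[s0 sT].
rewrite (@ge0_integral_itv_split f (c + s) (c + T)) ?lerD2l//; last first.
  by rewrite lerD2r lerDl.
rewrite (@ge0_integral_itv_split f c (c + s)) ?lerDl ?lerD2l//.
rewrite addeC; congr (_ + _)%E.
rewrite (@ge0_integral_affine _ 1 T) ?oner_eq0// normr1 mul1e.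
under eq_integral do rewrite mul1r fT.
congr integral; apply/seteqP; split => x /=; rewrite !in_itv/= mul1r => /andP[h1 h2];
  apply/andP; split; lra.
Qed.

Lemma Rintegral_period (f : R -> R) (T c s : R) :
  measurable_fun [set: R] f -> (forall x, f (x + T) = f x) -> 0 <= s <= T ->
  \int[mu]_(x in `[c + s, c + s + T]) f x = \int[mu]_(x in `[c, c + T]) f x.
Proof.
move=> mf fT sT; rewrite /Rintegral.
have mEf : measurable_fun [set: R] (EFin \o f) by exact/measurable_EFinP.
rewrite -!integral_itv_obnd_cbnd; try exact: measurable_funTS.
congr fine; rewrite [in LHS]integralE [in RHS]integralE.
congr (_ - _)%E; apply: ge0_integral_period => //.
- exact: measurable_funepos.
- by move=> x; rewrite !funeposE fT.
- exact: measurable_funeneg.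
- by move=> x; rewrite !funenegE fT.
Qed.

End period.

(** * Domination of powers of the logarithm by |w|^(-1/2) *)

Section kernel_bound.
Set Implicit Arguments.
Unset Strict Implicit.
Context {R : realType}.
Notation mu := (@lebesgue_measure R).
Implicit Types (a w x y : R).

(* [|w|^(-1/2)], with value [1] at [0] *)
Definition isqrt w : R := expR (- ln `|w| / 2).

Lemma measurable_isqrt : measurable_fun [set: R] isqrt.
Proof.
apply: (measurableT_comp (@measurable_expR R)).
apply: measurable_funM => //; apply: measurable_funN.
by apply: (measurableT_comp (@measurable_ln R)); exact: normr_measurable.
Qed.

Lemma continuous_isqrt x : 0 < x -> {for x, continuous isqrt}.
Proof.
move=> x0; apply: (@continuous_comp _ _ _ (fun y => - ln `|y| / 2) expR).
  apply: cvgM; last exact: cvg_cst.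
  apply: cvgN; apply: (@continuous_comp _ _ _ (fun y : R => `|y|) (@ln R)).
    exact: norm_continuous.
  by apply: continuous_ln; rewrite normr_gt0 gt_eqF.
exact: continuous_expR.
Qed.

(** For x > 0 this is 2 sqrt x, written so that the chain rule applies directly. *)
Let primitive : R -> R := 2 \*: (expR \o (2^-1 \*: @ln R)).

Lemma is_derive_isqrt_primitive x : 0 < x -> is_derive x 1 primitive (isqrt x).
Proof.
move=> x0; have dl := is_deriveZ 2^-1 (is_derive1_ln x0).
have de := is_derive1_comp (is_derive_expR _) dl.
apply: (@is_derive_eq _ _ _ _ _ _ _ _ (is_deriveZ 2 de)).
have -> : isqrt x = expR (2^-1 * ln x) * x^-1.
  rewrite /isqrt gtr0_norm//.
  have -> : - ln x / 2 = 2^-1 * ln x - ln x by field.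
  by rewrite expRB lnK.
by rewrite /GRing.scale/=; field; rewrite gt_eqF.
Qed.

(** The bound is independent of [e], so it survives the limit at the singularity. *)
Lemma integral_isqrt_le (e M : R) : 0 < e -> e < M ->
  (\int[mu]_(x in `[e, M]) (isqrt x)%:E <= (primitive M)%:E)%E.
Proof.
move=> e0 eM.
have cF x : 0 < x -> {for x, continuous primitive}.
  move=> x0; apply/differentiable_continuous/derivable1_diffP.
  by have [] := is_derive_isqrt_primitive x0.
rewrite (@continuous_FTC2 _ isqrt primitive)//.
- rewrite -EFinD lee_fin gerBl /primitive /GRing.scale/=.
  by rewrite mulr_ge0// expR_ge0.
- apply: continuous_in_subspaceT => x; rewrite inE/= in_itv/= => /andP[ex _].
  by apply: continuous_isqrt; lra.
- split.
  + move=> x; rewrite in_itv/= => /andP[ex _].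
    by have [] := @is_derive_isqrt_primitive x ltac:(lra).
  + by apply: cvg_at_right_filter; exact: cF.
  + by apply: cvg_at_left_filter; apply: cF; lra.
- move=> x; rewrite in_itv/= => /andP[ex _].
  have dx := @is_derive_isqrt_primitive x ltac:(lra).
  by rewrite derive1E derive_val.
Qed.

Lemma integral_isqrt_lty (M : R) : 0 < M ->
  (\int[mu]_(x in `]0%R, M]) (isqrt x)%:E < +oo)%E.
Proof.
(* Monotone convergence along closed intervals that exhaust []0, M]]; the offset 2 keeps every left
   endpoint strictly below [M]. *)
move=> M0; pose F (n : nat) : set R := `[M / n.+2%:R, M]%classic.
have UF : `]0, M]%classic = \bigcup_n F n.
  apply/seteqP; split => x /=.
    rewrite in_itv/= => /andP[h1 h2]; exists (Num.trunc (M / x)) => //.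
    rewrite /F/= in_itv/= h2 andbT.
    rewrite ler_pdivrMr ?ltr0n// mulrC -ler_pdivrMr//.
    by rewrite ltW// (lt_trans (truncnS_gt _))// ltr_nat.
  move=> [n _]; rewrite /F/= !in_itv/= => /andP[h1 ->].
  by rewrite andbT (lt_le_trans _ h1)// divr_gt0.
rewrite UF.
have ndF : {homo F : n m / (n <= m)%N >-> (n <= m)%O}.
  move=> n m nm; apply/subsetPset => x; rewrite /F/= !in_itv/= => /andP[h ->].
  rewrite andbT (le_trans _ h)// ler_pM2l// lef_pV2 ?posrE ?ltr0n//.
  by rewrite ler_nat !ltnS.
have mI D : measurable_fun D (EFin \o isqrt).
  by apply/measurable_EFinP/measurable_funTS; exact: measurable_isqrt.
have cvF : (\int[mu]_(x in F n) (EFin \o isqrt) x @[n --> \oo] -->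
    \int[mu]_(x in \bigcup_n F n) (EFin \o isqrt) x)%E.
  apply: ge0_nondecreasing_set_cvg_integral => //.
  - by move=> n; exact: measurable_itv.
  - by move=> ?; exact: mI.
  - by move=> n x _; exact: expR_ge0.
have <- := cvg_lim (@ereal_hausdorff R) cvF.
apply: (@le_lt_trans _ _ (primitive M)%:E); last exact: ltry.
apply: lime_le.
  apply: ereal_nondecreasing_is_cvgn => n m nm.
  apply: ge0_subset_integral; [exact: measurable_itv|exact: measurable_itv|exact: mI| |].
    by move=> x _; exact: expR_ge0.
  by apply/subsetPset; exact: ndF.
apply: nearW => n; apply: integral_isqrt_le; first by rewrite divr_gt0.
by rewrite ltr_pdivrMr// ltr_pMr// ltr1n.
Qed.

Lemma integrable_isqrt (M : R) : 0 < M ->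
  mu.-integrable `[- M, M] (EFin \o isqrt).
Proof.
move=> M0.
have mI D : measurable_fun D (EFin \o isqrt).
  by apply/measurable_EFinP/measurable_funTS; exact: measurable_isqrt.
have I0 x : (0 <= (EFin \o isqrt) x)%E by exact: expR_ge0.
apply/integrableP; split; first exact: mI.
under eq_integral do rewrite gee0_abs//.
rewrite -integral_itv_obnd_cbnd//.
rewrite (@ge0_integral_itv_split _ _ _ 0)// ?oppr_le0 1?ltW//.
apply: lte_add_pinfty; last exact: integral_isqrt_lty.
(* Reflection carries the negative half to the positive one, as [isqrt] is even. *)
rewrite (@ge0_integral_affine _ (-1) 0) ?oppr_eq0 ?oner_eq0//.
rewrite normrN1 mul1e.
have -> : (fun t : R => -1 * t + 0) @^-1` `](- M), 0] = `[0, M[%classic.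
  by apply/seteqP; split => x /=; rewrite !in_itv/= => /andP[h1 h2];
    apply/andP; split; lra.
under eq_integral do rewrite mulN1r addr0 /= /isqrt normrN.
rewrite integral_itv_bndo_bndc; last exact: mI.
rewrite -integral_itv_obnd_cbnd; last exact: mI.
exact: integral_isqrt_lty.
Qed.

(** The exponential absorbs the power: |l|^k is at most a constant times exp(|l|/2). As l <= 5 gives
    |l| <= 10 - l, this is at most e^5 exp(-l/2), and the lower bound on l turns exp(-l/2) into
    (c|w|)^(-1/2). *)
Lemma normrX_le_isqrt (k : nat) (c l w : R) : 0 < c -> w != 0 ->
  ln (c * `|w|) <= l -> l <= 5 ->
  `|l ^+ k| <= (2 * k.+1)%:R ^+ k * expR 5 * expR (- ln c / 2) * isqrt w.
Proof.
move=> c0 w0 cl l5.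
have q0 : (0 : R) < (2 * k.+1)%:R by rewrite ltr0n.
(* [t <= exp t] at [t = |l| / (2 (k + 1))], raised to the power [k] *)
have h1 : `|l| ^+ k <= (2 * k.+1)%:R ^+ k * expR (`|l| / 2).
  have h : `|l| <= (2 * k.+1)%:R * expR (`|l| / (2 * k.+1)%:R).
    rewrite -ler_pdivrMl// mulrC (le_trans _ (expR_ge1Dx _))// lerDr//.
  apply: (@le_trans _ _ (((2 * k.+1)%:R * expR (`|l| / (2 * k.+1)%:R)) ^+ k)).
    by apply: lerXn2r => //; rewrite nnegrE mulr_ge0 ?expR_ge0// ltW.
  rewrite exprMn; apply: ler_wpM2l; first by rewrite exprn_ge0 ?ltW.
  rewrite -expRM_natr ler_expR.
  rewrite natrM invfM mulrA -[leLHS]mulrA ler_piMr ?divr_ge0//.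
  rewrite ler_pdivrMl ?ltr0n// mulr1 ler_nat//.
rewrite normrX (le_trans h1)// -!mulrA.
apply: ler_wpM2l; first by rewrite exprn_ge0 ?ltW.
rewrite /isqrt -!expRD ler_expR.
move: cl; rewrite lnM ?posrE ?normr_gt0// => cl.
have : `|l| <= 10 - l by rewrite ler_norml; apply/andP; split; lra.
lra.
Qed.

(** The mean value theorem gives y cos y <= sin y. At y = x/2 this yields sin x >= x cos^2(x/2), and
    cos x >= 0 means cos^2(x/2) >= 1/2. *)
Lemma sin_ge_half x : 0 <= x <= pi / 2 -> x / 2 <= sin x.
Proof.
move=> /andP[x0 xpi].
have yc y : 0 <= y <= pi / 2 -> y * cos y <= sin y.
  rewrite le_eqVlt => /andP[/predU1P[<-|y0] ypi]; first by rewrite mul0r sin0.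
  have [|z zy] := @MVT R sin cos 0 y y0 (fun x _ => is_derive_sin x).
    by apply: continuous_subspaceT; exact: continuous_sin.
  rewrite sin0 !subr0 => ->; rewrite mulrC ler_pM2r//.
  move: zy; rewrite in_itv/= => /andP[z0 zy].
  have p0 := @pi_gt0 R.
  rewrite ltW// ltr_cos ?in_itv/=//; apply/andP; split; lra.
have xE : x = x / 2 + x / 2 by field.
have x2 : 0 <= x / 2 <= pi / 2 by have p0 := @pi_gt0 R; apply/andP; split; lra.
have h := yc _ x2.
have c0 : 0 <= cos (x / 2).
  by rewrite cos_ge0_pihalf//; apply/andP; split; lra.
have cx : 0 <= cos x by rewrite cos_ge0_pihalf//; apply/andP; split; lra.
rewrite {2}xE sinD; move: cx; rewrite {1}xE cosD -!expr2 sin2cos2 => cx.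
nra.
Qed.

(** For |w| <= pi/2 the term sin^2 w suffices; beyond that the cosine is nonpositive, so the squared
    modulus is at least 1, and pi < 4. *)
Lemma logdist_arg_ge a w : 0 <= a -> - pi <= w <= pi ->
  (4^-1 * `|w|) ^+ 2 <= 1 + a ^+ 2 - 2 * a * cos w.
Proof.
move=> a0 wpi.
have p0 := @pi_gt0 R; have p2 := @pihalf_lt2 R.
have nwpi : `|w| <= pi by rewrite ler_norml.
have nw0 := normr_ge0 w.
rewrite -(cos_norm w); set v := `|w| in nwpi nw0 *.
have [vp|vp] := leP v (pi / 2).
  have h : v / 2 <= sin v by rewrite sin_ge_half//; apply/andP; split.
  rewrite logdist_arg; have := sqr_ge0 (a - cos v); nra.
have h : cos v <= 0.
  rewrite -[v](subrK (pi / 2)) cosDpihalf oppr_le0 sin_ge0_pi//; lra.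
nra.
Qed.

Lemma logdist_bound (k : nat) a w : 0 <= a <= 2 -> - pi <= w <= pi -> w != 0 ->
  `|logdist a w ^+ k| <=
    (2 * k.+1)%:R ^+ k * expR 5 * expR (- ln 4^-1 / 2) * isqrt w.
Proof.
move=> /andP[a0 a2] wpi w0.
have h := logdist_arg_ge a0 wpi.
have p : 0 < 4^-1 * `|w| by rewrite mulr_gt0 ?invr_gt0 ?normr_gt0.
have P := lt_le_trans (exprn_gt0 2 p) h.
apply: normrX_le_isqrt => //.
  have : ln ((4^-1 * `|w|) ^+ 2) <= ln (1 + a ^+ 2 - 2 * a * cos w).
    by rewrite ler_ln ?posrE ?exprn_gt0.
  by rewrite lnXn// -mulr_natr /logdist; lra.
(* The argument P is at most (1 + a)^2 <= 9 and ln P < P, so half the logarithm stays below 5. *)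
rewrite /logdist; have := ln_sublinear P.
have := cos_geN1 w; nra.
Qed.

End kernel_bound.

(** * Periodicity, parity, measurability and boundedness of [rho] *)

Section rho.
Set Implicit Arguments.
Unset Strict Implicit.
Context {R : realType}.
Notation mu := (@lebesgue_measure R).
Implicit Types (a w x y : R) (f g : R -> R).

Lemma integrable_bounded f (c d M : R) : measurable_fun [set: R] f ->
  (forall x, c <= x <= d -> `|f x| <= M) -> mu.-integrable `[c, d] (EFin \o f).
Proof.
move=> mf fM; apply: measurable_bounded_integrable.
- exact: measurable_itv.
- by apply: compact_finite_measure; exact: segment_compact.
- exact: measurable_funTS.
- exists M; split; first exact: num_real.
  by move=> N MN x /=; rewrite in_itv/= => /fM /le_trans; apply; exact: ltW.
Qed.

(** The bound is asked only off 0, where [isqrt] takes a conventional value; a single point is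
    negligible. *)
Lemma integrable_le_isqrt f (C M : R) : 0 < M -> measurable_fun [set: R] f ->
  (forall w, - M <= w <= M -> w != 0 -> `|f w| <= C * isqrt w) ->
  mu.-integrable `[- M, M] (EFin \o f).
Proof.
move=> M0 mf fC.
have mI : measurable (`[- M, M] : set (measurableTypeR R)) by exact: measurable_itv.
apply/(@negligible_integrable _ _ _ mu _ [set (0 : R)]);
  [exact: measurable_set1|exact: mI| |exact: lebesgue_measure_set1|].
  exact/measurable_EFinP/measurable_funTS.
have mD : measurable (`[- M, M] `\` [set 0] : set (measurableTypeR R)) by exact: measurableD.
have ii : mu.-integrable (`[- M, M] `\` [set 0]) (EFin \o isqrt).
  by apply: (integrableS mI mD) => //; exact: integrable_isqrt.
have iI : mu.-integrable (`[- M, M] `\` [set 0]) (fun x => C%:E * (EFin \o isqrt) x)%E.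
  exact: (integrableZl mD).
apply: le_integrable iI; first exact: measurableD.
  exact/measurable_EFinP/measurable_funTS.
move=> x [] /=; rewrite in_itv/= => xM /eqP x0.
by rewrite lee_fin (le_trans (fC _ xM x0))// ler_norm.
Qed.

(** The right-hand side depends on [f] only through [C], which is what makes the bound on [rho]
    uniform in its argument. *)
Lemma norm_Rintegral_le_isqrt f (C M : R) : 0 < M -> measurable_fun [set: R] f ->
  (forall w, - M <= w <= M -> w != 0 -> `|f w| <= C * isqrt w) ->
  `|\int[mu]_(w in `[- M, M]) f w| <=
    C * \int[mu]_(w in `[- M, M] `\` [set 0]) isqrt w.
Proof.
move=> M0 mf fC; have fi := integrable_le_isqrt M0 mf fC.
have mI : measurable (`[- M, M] : set (measurableTypeR R)) by exact: measurable_itv.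
have mD : measurable (`[- M, M] `\` [set 0] : set (measurableTypeR R)) by exact: measurableD.
have -> : \int[mu]_(w in `[- M, M]) f w = \int[mu]_(w in `[- M, M] `\` [set 0]) f w.
  rewrite /Rintegral (@negligible_integral _ _ _ mu _ [set (0 : R)])//.
  exact: lebesgue_measure_set1.
have fi' : mu.-integrable (`[- M, M] `\` [set 0]) (EFin \o f).
  exact: (integrableS mI mD).
have ii : mu.-integrable (`[- M, M] `\` [set 0]) (EFin \o isqrt).
  by apply: (integrableS mI mD) => //; exact: integrable_isqrt.
rewrite (le_trans (le_normr_Rintegral mD fi'))// -RintegralZl//.
apply: le_Rintegral => //.
- exact: (integrable_norm fi').
- exact: (integrableZl mD C ii).
- by move=> x [] /=; rewrite in_itv/= => xM /eqP x0; exact: fC.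
Qed.

Lemma measurable_logdistX n a : measurable_fun [set: R] (fun w => logdist a w ^+ n).
Proof. by apply: measurable_funX; exact: measurable_logdist. Qed.

Lemma Rintegral_2pi_periodic f c : measurable_fun [set: R] f ->
  (forall x, f (x + 2 * pi) = f x) -> - (3 * pi) <= c <= pi ->
  \int[mu]_(x in `[c, c + 2 * pi]) f x = \int[mu]_(x in `[- pi, pi]) f x.
Proof.
move=> mf fp /andP[c3 cpi].
(* [Rintegral_period] only shifts to the right, so it starts from whichever window lies further
   left. *)
have [h|h] := leP (- pi) c.
  have := @Rintegral_period R f (2 * pi) (- pi) (c + pi) mf fp.
  rewrite (_ : - pi + (c + pi) = c); last by ring.
  rewrite (_ : - pi + 2 * pi = pi); last by ring.
  by apply; apply/andP; split; lra.
have := @Rintegral_period R f (2 * pi) c (- pi - c) mf fp.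
rewrite (_ : c + (- pi - c) = - pi); last by ring.
rewrite (_ : - pi + 2 * pi = pi); last by ring.
by move=> <-//; apply/andP; split; lra.
Qed.

Lemma Rintegral_shift_periodic f c : measurable_fun [set: R] f ->
  (forall x, f (x + 2 * pi) = f x) -> - pi <= c <= pi ->
  \int[mu]_(t in `[0, 1]) f (2 * pi * t + c) =
  (2 * pi)^-1 * \int[mu]_(x in `[- pi, pi]) f x.
Proof.
move=> mf fp /andP[c1 c2]; have p0 := @pi_gt0 R.
have p20 : 0 < 2 * pi :> R by lra.
rewrite -(@Rintegral_2pi_periodic f c)//; last by apply/andP; split; lra.
rewrite (@Rintegral_affine _ (2 * pi) c _ f (lt0r_neq0 p20) (measurable_itv _) mf).
rewrite gtr0_norm// mulrA mulVf ?gt_eqF// mul1r.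
congr (Rintegral _ _ _); apply/seteqP; split => x /=; rewrite !in_itv/= => /andP[h1 h2].
  by apply/andP; split; nra.
apply/andP; split.
  by rewrite -(pmulr_rge0 _ p20); lra.
by rewrite -(ler_pM2l p20); lra.
Qed.

(** Rotating the circle by pi exchanges [a] and [- a]. *)
Lemma rhoN n a : rho n (- a) = rho n a.
Proof.
have p0 := @pi_gt0 R.
rewrite !rhoE; congr (_ * _).
rewrite -(@Rintegral_2pi_periodic _ 0); last 3 first.
- exact: measurable_logdistX.
- by move=> x; rewrite logdistD2pi.
- by apply/andP; split; lra.
rewrite (@Rintegral_affine _ 1 pi _ _ (oner_neq0 _) (measurable_itv _)); last first.
  exact: measurable_logdistX.
rewrite normr1 mul1r.
under eq_Rintegral do rewrite mul1r logdistDpi opprK.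
congr (Rintegral _ _ _).
by apply/seteqP; split => x /=; rewrite !in_itv/= => /andP[h1 h2]; apply/andP; split; lra.
Qed.

Lemma mean_Relog_sum n v : 0 <= v <= pi ->
  \int[mu]_(t in `[0, 1]) Relog (1 + expi (2 * pi * t) + expi (v + v)) ^+ n =
  rho n (2 * cos v).
Proof.
move=> /andP[v0 vpi]; have p0 := @pi_gt0 R.
under eq_Rintegral do rewrite Relog_sum_expi.
rewrite rhoE -(@Rintegral_shift_periodic _ (pi - v))//.
- exact: measurable_logdistX.
- by move=> x; rewrite logdistD2pi.
- by apply/andP; split; lra.
Qed.

(** Tonelli makes the partial integrals of the positive and negative parts of the jointly measurable
    kernel measurable; the indicator of [[- pi, pi]] moves the domain into the integrand. *)
Lemma measurable_rho n : measurable_fun [set: R] (@rho R n).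
Proof.
pose D : set R := `[- pi, pi]%classic.
pose F (p : measurableTypeR R * measurableTypeR R) : \bar R :=
  (logdist p.1 p.2 ^+ n * \1_D p.2)%:E.
have mF : measurable_fun setT F.
  apply/measurable_EFinP; apply: measurable_funM.
    by apply: measurable_funX; exact: measurable_logdist2.
  have mD : measurable_fun [set: measurableTypeR R] (\1_D : measurableTypeR R -> R).
    by apply: measurable_indic; exact: measurable_itv.
  exact: (measurableT_comp mD measurable_snd).
have -> : @rho R n = fun a =>
    (2 * pi)^-1 * fine (\int[mu]_y F^\+%E (a, y) - \int[mu]_y F^\-%E (a, y))%E.
  apply/funext => a; rewrite rhoE; congr (_ * _).
  rewrite /Rintegral integral_mkcond; congr fine; rewrite integralE; congr (_ - _)%E.
    apply: eq_integral => y _; rewrite !funeposE; congr maxe.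
    by rewrite /F patchE indicE/=; case: (y \in _); rewrite ?mulr1 ?mulr0.
  apply: eq_integral => y _; rewrite !funenegE; congr (maxe (- _)%E _).
  by rewrite /F patchE indicE/=; case: (y \in _); rewrite ?mulr1 ?mulr0.
apply: measurable_funM => //.
apply: (measurableT_comp (f := fine)); first exact: fine_measurable.
apply: emeasurable_funB.
- apply: (@measurable_fun_fubini_tonelli_F _ _ (measurableTypeR R) (measurableTypeR R)
    R mu F^\+%E) => //.
  exact: measurable_funepos.
- apply: (@measurable_fun_fubini_tonelli_F _ _ (measurableTypeR R) (measurableTypeR R)
    R mu F^\-%E) => //.
  exact: measurable_funeneg.
Qed.

Lemma rho_bounded n : exists M, forall a, `|a| <= 2 -> `|rho n a| <= M.
Proof.
have p0 := @pi_gt0 R.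
pose C : R := (2 * n.+1)%:R ^+ n * expR 5 * expR (- ln 4^-1 / 2).
exists ((2 * pi)^-1 * (C * \int[mu]_(w in `[- pi, pi] `\` [set 0]) isqrt w)) => a a2.
(* Parity reduces to a nonnegative argument, the range covered by [logdist_bound]. *)
have -> : rho n a = rho n `|a|.
  by have [_|_] := ler0P a; rewrite ?rhoN.
rewrite rhoE normrM gtr0_norm; last by rewrite invr_gt0; lra.
apply: ler_wpM2l; first by rewrite invr_ge0; lra.
apply: norm_Rintegral_le_isqrt => //; first exact: measurable_logdistX.
by move=> w wpi w0; apply: logdist_bound; rewrite ?normr_ge0.
Qed.

Lemma rho0 a : rho 0 a = 1.
Proof.
have p0 := @pi_gt0 R.
rewrite rhoE; under eq_Rintegral do rewrite expr0.
rewrite Rintegral_cst/=; last exact: measurable_itv.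
rewrite lebesgue_measure_itv/= lte_fin ifT; last by lra.
rewrite -EFinD/=; move: (@pi R) p0 => p p0.
by field; exact: lt0r_neq0.
Qed.

End rho.

(** * Vanishing of [rho 1] on [0, 1[ and binomial expansion of [rho n] beyond 1 *)

Section rho_expansion.
Set Implicit Arguments.
Unset Strict Implicit.
Context {R : realType}.
Notation mu := (@lebesgue_measure R).
Implicit Types (a w x y : R) (f g : R -> R).

Lemma Rintegral_sum (I : Type) (s : seq I) (D : set (measurableTypeR R))
    (f : I -> R -> R) :
  measurable D -> (forall i, mu.-integrable D (EFin \o f i)) ->
  \int[mu]_(x in D) (\sum_(i <- s) f i x) = \sum_(i <- s) \int[mu]_(x in D) f i x.
Proof.
move=> mD fi; elim: s => [|i s IH].
  under eq_Rintegral do rewrite big_nil.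
  by rewrite big_nil Rintegral_cst// mul0r.
under eq_Rintegral do rewrite big_cons.
rewrite big_cons RintegralD// ?IH//.
have -> : EFin \o (fun x => \sum_(j <- s) f j x) =
    (fun x => \sum_(j <- s) (EFin \o f j) x)%E.
  by apply/funext => x /=; rewrite sumEFin.
by apply: integrable_sum => // j _; exact: fi.
Qed.

Lemma logdist_bounded a : `|a| < 1 -> exists M, forall w, `|logdist a w| <= M.
Proof.
move=> a1; have q : 0 < (1 - `|a|) ^+ 2 by rewrite exprn_gt0// subr_gt0.
(* The squared modulus lies between (1 - |a|)^2 and 4, and ln P < P. *)
exists (4 + `|ln ((1 - `|a|) ^+ 2)|) => w.
have ac : `|a * cos w| <= `|a| by rewrite normrM ler_piMr// cos_max.
have h : (1 - `|a|) ^+ 2 <= 1 + a ^+ 2 - 2 * a * cos w.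
  by move: ac; rewrite ler_norml -(real_normK (num_real a)) => /andP[_ h]; nra.
have P := lt_le_trans q h.
have : ln ((1 - `|a|) ^+ 2) <= ln (1 + a ^+ 2 - 2 * a * cos w).
  by rewrite ler_ln ?posrE.
have h2 : 1 + a ^+ 2 - 2 * a * cos w <= 4.
  move: ac; rewrite ler_norml -(real_normK (num_real a)) => /andP[h2 _].
  by have := normr_ge0 a; nra.
have := ln_sublinear P.
set u := ln (_ ^+ 2); have := ler_norm (- u); have := normr_ge0 u.
rewrite normrN /logdist => ? ? ? ?.
by rewrite ler_norml; apply/andP; split; lra.
Qed.

Lemma integrable_logdistX_lt1 n a (c d : R) : `|a| < 1 ->
  mu.-integrable `[c, d] (EFin \o (fun w => logdist a w ^+ n)).
Proof.
move=> /logdist_bounded[M aM].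
apply: (@integrable_bounded _ _ _ _ (M ^+ n)); first exact: measurable_logdistX.
by move=> x _; rewrite normrX; apply: lerXn2r; rewrite ?nnegrE// (le_trans _ (aM x)).
Qed.

(** Doubling the angle covers two periods, [[- 2 pi, 0]] and [[0, 2 pi]], and the Jacobian 2
    compensates. *)
Lemma Rintegral_logdist_double a : `|a| < 1 ->
  \int[mu]_(w in `[- pi, pi]) logdist a (2 * w) =
  \int[mu]_(w in `[- pi, pi]) logdist a w.
Proof.
move=> a1; have p0 := @pi_gt0 R.
have mL := measurable_logdist a.
have iL : mu.-integrable `[(- (2 * pi)), 2 * pi] (EFin \o logdist a).
  exact: (integrable_logdistX_lt1 1).
have h1 := @Rintegral_affine _ 2 0 `[(- (2 * pi)), 2 * pi] _
  (lt0r_neq0 (ltr0n _ 2)) (measurable_itv _) mL.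
have pre : (fun t : R => 2 * t + 0) @^-1` `[(- (2 * pi)), 2 * pi] = `[- pi, pi]%classic.
  by apply/seteqP; split => x /=; rewrite !in_itv/= => /andP[k1 k2]; apply/andP; split; lra.
have h2 := @Rintegral_itvB _ _ _ _ 0 iL
  ltac:(rewrite bnd_simp; lra) ltac:(rewrite bnd_simp; lra).
have L2 x : logdist a (x + 2 * pi) = logdist a x by rewrite logdistD2pi.
have h3 := @Rintegral_2pi_periodic _ (logdist a) (- (2 * pi)) mL L2 ltac:(lra).
have h4 := @Rintegral_2pi_periodic _ (logdist a) 0 mL L2 ltac:(lra).
rewrite addNr in h3; rewrite add0r in h4.
rewrite Rintegral_itv_obnd_cbnd in h2; last first.
  have := integrable_logdistX_lt1 1 0 (2 * pi) a1.
  apply: integrableS;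
    [exact: measurable_itv|exact: measurable_itv|].
  by apply: subset_itvr; rewrite bnd_simp.
have h5 : \int[mu]_(w in `[- pi, pi]) logdist a (2 * w + 0) =
    \int[mu]_(w in `[- pi, pi]) logdist a (2 * w).
  by apply: eq_Rintegral => w _; rewrite addr0.
move: h1 h2; rewrite pre h3 h4 h5 normr_nat => -> h2.
lra.
Qed.

Lemma rho1_double a : 0 <= a < 1 -> 2 * rho 1 a = rho 1 (a ^+ 2).
Proof.
move=> /andP[a0 a1]; have na1 : `|a| < 1 by rewrite ger0_norm.
have nna1 : `|- a| < 1 by rewrite normrN.
have na2 : `|a ^+ 2| < 1 by rewrite normrX expr_lt1.
rewrite mulr_natl mulr2n -{2}rhoN !rhoE -mulrDr; congr (_ * _).
rewrite -RintegralD; [|exact: measurable_itv|exact: integrable_logdistX_lt1|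
  exact: integrable_logdistX_lt1].
under eq_Rintegral do rewrite !expr1 logdist_double//.
by rewrite Rintegral_logdist_double.
Qed.

(** Iterated squaring gives 2^m rho_1(a) = rho_1(a^(2^m)), which stays bounded as m grows. *)
Lemma rho1_eq0 a : 0 <= a < 1 -> rho 1 a = 0.
Proof.
move=> a01; have [M rM] := @rho_bounded R 1.
have h m b : 0 <= b < 1 -> 2 ^+ m * `|rho 1 b| <= M.
  elim: m b => [|m IH] b /andP[b0 b1].
    by rewrite expr0 mul1r rM// ger0_norm//; lra.
  rewrite exprSr -mulrA -[X in _ * (X * _)]normr_nat -normrM rho1_double ?b0//.
  by apply: IH; rewrite sqr_ge0 expr_lt1.
apply/eqP; rewrite -normr_eq0; apply/negP => /negP r0.
have {}r0 : 0 < `|rho 1 a| by rewrite lt_neqAle eq_sym r0 normr_ge0.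
(* This exponent m exceeds M / |rho_1(a)|, and 2^m > m contradicts the bound. *)
have := h (Num.trunc (M / `|rho 1 a|)).+1 a a01.
rewrite -ler_pdivlMr//; apply/negP; rewrite -ltNge.
rewrite (lt_trans (truncnS_gt _))// -natrX ltr_nat.
exact: ltn_expl.
Qed.

Lemma rho_gt1 n a : 1 < a -> rho n a =
  \sum_(0 <= k < n.+1) 'C(n, k)%:R * (ln a ^+ (n - k) * rho k a^-1).
Proof.
move=> a1; have ia1 : `|a^-1| < 1.
  by rewrite gtr0_norm ?invr_gt0 ?invf_lt1//; lra.
have iL k := @integrable_logdistX_lt1 k a^-1 (- pi) pi ia1.
have mI : measurable (`[- pi, pi] : set (measurableTypeR R)) by exact: measurable_itv.
rewrite rhoE; under eq_Rintegral.
  move=> w _; rewrite logdist_inv// exprDn.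
  under eq_bigr do rewrite -mulr_natl mulrA.
  over.
rewrite Rintegral_sum//; last first.
  by move=> k; exact: (integrableZl mI ('C(n, k)%:R * ln a ^+ (n - k)) (iL k)).
rewrite mulr_sumr big_mkord; apply: eq_bigr => k _.
by rewrite RintegralZl// rhoE; ring.
Qed.

End rho_expansion.

(** * From the Mahler measure to [rho], and the log-sine integrals *)

Section mahler.
Set Implicit Arguments.
Unset Strict Implicit.
Context {R : realType}.
Notation mu := (@lebesgue_measure R).
Implicit Types (x y : R) (f g : R -> R).

(** The triple-angle formula at pi/2 reads (s + 1)(2s - 1)^2 = 0 for s = sin(pi/6), and s >= 0
    excludes the root -1. *)
Lemma sin_pi6 : sin (pi / 6) = 2^-1 :> R.
Proof.
have p0 := @pi_gt0 R.
set x : R := pi / 6; set s := sin x.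
have s0 : 0 <= s by rewrite sin_ge0_pi//; apply/andP; rewrite /x; split; lra.
have h : 3 * s * (1 - s ^+ 2) - s ^+ 3 = 1.
  rewrite -cos2sin2; transitivity (sin (x + x + x)).
    by rewrite sinD sinD cosD /s; ring.
  by rewrite (_ : x + x + x = pi / 2) ?sin_pihalf// /x; lra.
have /eqP : (s + 1) * (2 * s - 1) ^+ 2 = 0 by lra.
by rewrite mulf_eq0 expf_eq0/= => /orP[/eqP|/eqP]; lra.
Qed.

Lemma measurable_2sin : measurable_fun [set: R] (fun x => 2 * sin x).
Proof. by apply: measurable_funM => //; exact: measurable_sin. Qed.

Lemma norm_2sin_le x : `|2 * sin x| <= 2.
Proof. by rewrite normrM normr_nat ler_piMr// sin_max. Qed.

Lemma measurable_rho_2sin n : measurable_fun [set: R] (fun x => rho n (2 * sin x)).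
Proof. exact: (measurableT_comp (measurable_rho n) measurable_2sin). Qed.

Lemma integrable_rho_2sin n (c d : R) :
  mu.-integrable `[c, d] (EFin \o (fun x => rho n (2 * sin x))).
Proof.
have [M rM] := @rho_bounded R n.
apply: (@integrable_bounded _ _ _ _ M); first exact: measurable_rho_2sin.
by move=> x _; rewrite rM ?norm_2sin_le.
Qed.

Lemma itv_sym_rescale (p x : R) : 0 < p ->
  (- (p / 2) <= - p * x + p / 2 <= p / 2) = (0 <= x <= 1).
Proof.
move=> p0.
have -> : (- (p / 2) <= - p * x + p / 2) = (x <= 1).
  by rewrite -subr_ge0 -[RHS]subr_ge0 -[RHS](pmulr_rge0 _ p0); congr (_ <= _); field.
have -> : (- p * x + p / 2 <= p / 2) = (0 <= x).
  by rewrite -subr_ge0 -[RHS](pmulr_rge0 _ p0); congr (_ <= _); field.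
by rewrite andbC.
Qed.

Lemma Rintegral_even f (c : R) : 0 <= c -> measurable_fun [set: R] f ->
  (forall x, f (- x) = f x) -> mu.-integrable `[- c, c] (EFin \o f) ->
  \int[mu]_(x in `[- c, c]) f x = 2 * \int[mu]_(x in `[0, c]) f x.
Proof.
move=> c0 mf fN fi.
have h1 := @Rintegral_itvB _ _ _ _ 0 fi
  ltac:(rewrite bnd_simp; lra) ltac:(rewrite bnd_simp; lra).
rewrite Rintegral_itv_obnd_cbnd in h1; last first.
  apply: integrableS fi;
    [exact: measurable_itv|exact: measurable_itv|].
  by apply: subset_itvr; rewrite bnd_simp; lra.
have n1 : -1 != 0 :> R by rewrite oppr_eq0 oner_eq0.
have h2 := Rintegral_affine 0 n1 (measurable_itv `[- c, 0]) mf.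
have pre : (fun t : R => -1 * t + 0) @^-1` `[- c, 0] = `[0, c]%classic.
  by apply/seteqP; split => x /=; rewrite !in_itv/= => /andP[k1 k2]; apply/andP; split; lra.
have h3 : \int[mu]_(x in `[0, c]) f (-1 * x + 0) = \int[mu]_(x in `[0, c]) f x.
  by apply: eq_Rintegral => x _; rewrite addr0 mulN1r fN.
rewrite pre h3 normrN1 in h2; lra.
Qed.

Lemma eq_mulf_div (p x y z : R) : 0 < p -> z * x = p * y -> y = z / p * x.
Proof.
by move=> q h; rewrite mulrAC h mulrAC divff ?gt_eqF// mul1r.
Qed.

(** The substitution x = pi/2 - pi u turns cos(pi u) into sin x over [[- pi/2, pi/2]]; parity of
    [rho] folds this onto the positive half. *)
Lemma mahler_1xy_rho n :
  mahler_1xy R n = 2 / pi * \int[mu]_(x in `[0, pi / 2]) rho n (2 * sin x).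
Proof.
have p0 := @pi_gt0 R.
have mH := measurable_rho_2sin n.
have -> : mahler_1xy R n =
    \int[mu]_(u in `[0, 1]) rho n (2 * sin (- pi * u + pi / 2)).
  apply: eq_Rintegral => u; rewrite inE/= in_itv/= => /andP[u0 u1].
  rewrite (_ : 2 * pi * u = pi * u + pi * u); last by rewrite -mulrA mulr_natl mulr2n.
  rewrite mean_Relog_sum; last first.
    by apply/andP; split; [exact: mulr_ge0 (ltW p0) u0|rewrite ler_piMr// ltW].
  by rewrite sinDpihalf mulNr cosN.
have pn0 : - pi != 0 :> R by rewrite oppr_eq0 gt_eqF.
have h1 := Rintegral_affine (pi / 2) pn0 (measurable_itv `[(- (pi / 2)), pi / 2]) mH.
have pre : (fun t : R => - pi * t + pi / 2) @^-1` `[(- (pi / 2)), pi / 2] = `[0, 1]%classic.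
  by apply/funext => x; rewrite /= !in_itv/= itv_sym_rescale.
have np : `|- pi| = pi :> R by rewrite normrN gtr0_norm.
have h2 : \int[mu]_(x in `[(- (pi / 2)), pi / 2]) rho n (2 * sin x) =
    2 * \int[mu]_(x in `[0, pi / 2]) rho n (2 * sin x).
  have c0 : 0 <= pi / 2 :> R by rewrite divr_ge0 ?ltW.
  have Heven x : rho n (2 * sin (- x)) = rho n (2 * sin x).
    by rewrite sinN mulrN rhoN.
  exact: Rintegral_even c0 mH Heven (integrable_rho_2sin n _ _).
rewrite pre np h2 in h1.
exact: (eq_mulf_div p0 h1).
Qed.

(** The minus sign in [Ls] leaves the integral over []pi / 3, pi]]; halving the angle gives the
    factor 2, and the sine is positive there, so the absolute value drops. *)
Lemma Ls_sub_pi n : Ls n.+1 (pi / 3) - Ls n.+1 pi =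
  2 * \int[mu]_(x in `]pi / 6, pi / 2]) ln (2 * sin x) ^+ n.
Proof.
have p0 := @pi_gt0 R.
pose f x : R := ln `|2 * sin (x / 2)| ^+ n.
have mf : measurable_fun [set: R] f.
  apply: measurable_funX; apply: (measurableT_comp (@measurable_ln R)).
  apply: (measurableT_comp (@normr_measurable R setT)).
  apply: measurable_funM => //; apply: (measurableT_comp measurable_sin).
  exact: measurable_funM.
(* The singularity at 0 is logarithmic, since [sin_ge_half] bounds |2 sin(w/2)| below by a multiple
   of |w|. *)
have bf w : - pi <= w <= pi -> w != 0 -> `|f w| <=
    (2 * n.+1)%:R ^+ n * expR 5 * expR (- ln 4^-1 / 2) * isqrt w.
  move=> /andP[w1 w2] w0.
  have h : 4^-1 * `|w| <= `|2 * sin (w / 2)|.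
    have : `|w| / 2 / 2 <= sin (`|w| / 2).
      apply: sin_ge_half; rewrite divr_ge0//= ler_pM2r ?invr_gt0//.
      by rewrite ler_norml w1.
    rewrite normrM normr_nat.
    have [wp|wn] := ger0P w.
      by have := ler_norm (sin (w / 2)); lra.
    by rewrite mulNr sinN; have := ler_norm (- sin (w / 2)); rewrite normrN; lra.
  have q : 0 < 4^-1 * `|w| by rewrite mulr_gt0 ?invr_gt0 ?normr_gt0.
  have Q := lt_le_trans q h.
  apply: normrX_le_isqrt => //; first by rewrite ler_ln.
  have := ln_sublinear Q; have := norm_2sin_le (w / 2); lra.
have fi : mu.-integrable `[0, pi] (EFin \o f).
  apply: integrableS (integrable_le_isqrt p0 mf bf);
    [exact: measurable_itv|exact: measurable_itv|].
  by apply: subset_itvr; rewrite bnd_simp; lra.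
have h1 := @Rintegral_itvB _ _ _ _ (pi / 3) fi
  ltac:(rewrite bnd_simp; lra) ltac:(rewrite bnd_simp; lra).
rewrite /Ls /= opprK addrC; rewrite /f in h1; rewrite h1.
rewrite (Rintegral_affine 0 (lt0r_neq0 (ltr0n R 2)) (measurable_itv `]pi / 3, pi]) mf).
rewrite normr_nat; congr (_ * _).
have -> : (fun t : R => 2 * t + 0) @^-1` `]pi / 3, pi] = `]pi / 6, pi / 2]%classic.
  by apply/seteqP; split => x /=; rewrite !in_itv/= => /andP[k1 k2]; apply/andP; split; lra.
apply: eq_Rintegral => x; rewrite inE/= in_itv/= => /andP[k1 k2].
rewrite /f addr0 (mulrC 2 x) mulfK// ger0_norm// mulr_ge0// sin_ge0_pi//.
by apply/andP; split; lra.
Qed.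

Lemma twosin_gt1 x : pi / 6 < x <= pi / 2 -> 1 < 2 * sin x.
Proof.
move=> /andP[x1 x2]; have p0 := @pi_gt0 R.
have : sin (pi / 6) < sin x.
  by rewrite ltr_sin ?in_itv/= //; apply/andP; split; lra.
rewrite sin_pi6; lra.
Qed.

Lemma integrable_ln_rho n k :
  mu.-integrable `[pi / 6, pi / 2]
    (EFin \o (fun x => ln (2 * sin x) ^+ n * rho k (2 * sin x)^-1)).
Proof.
have p0 := @pi_gt0 R; have [M rM] := @rho_bounded R k.
have sge1 x : x \in `[pi / 6, pi / 2]%classic -> 1 <= 2 * sin x.
  rewrite inE/= in_itv/= => /andP[]; rewrite le_eqVlt => /predU1P[<- _|h1 h2].
    by rewrite sin_pi6 divff.
  by rewrite ltW// twosin_gt1// h1.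
(* The real power -1 is measurable on the whole line and agrees with the inverse where 2 sin x >=
   1. *)
pose g x : R := ln (2 * sin x) ^+ n * rho k ((2 * sin x) `^ (- 1)).
have mI : measurable (`[pi / 6, pi / 2] : set (measurableTypeR R)) by exact: measurable_itv.
suff : mu.-integrable `[pi / 6, pi / 2] (EFin \o g).
  apply: (eq_integrable mI) => x /sge1 h /=.
  by rewrite /g powR_inv1// (le_trans ler01).
apply: (@integrable_bounded _ _ _ _ (2 ^+ n * M)).
  apply: measurable_funM.
    apply: measurable_funX; apply: (measurableT_comp (@measurable_ln R)).
    exact: measurable_2sin.
  apply: (measurableT_comp (measurable_rho k)).
  exact: (measurableT_comp (measurable_powR (- 1)) measurable_2sin).
move=> x xI; have h : 1 <= 2 * sin x by apply: sge1; rewrite inE/= in_itv.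
have h2 : 2 * sin x <= 2 by rewrite (le_trans (ler_norm _))// norm_2sin_le.
rewrite normrM ler_pM//.
  rewrite normrX; apply: lerXn2r; rewrite ?nnegrE//.
  by rewrite ger0_norm ?ln_ge0// (le_trans (ltW (ln_sublinear _)))//; lra.
have s0 : 0 < 2 * sin x by exact: lt_le_trans h.
have i1 : (2 * sin x)^-1 <= 1 by rewrite invf_le1.
apply: rM; rewrite powR_inv1 ?ltW// ger0_norm ?invr_ge0 ?ltW//.
by rewrite (le_lt_trans i1)// ltr1n.
Qed.

(** The interval is open at pi/6, where 2 sin x = 1, because [rho_gt1] needs a strict inequality. *)
Lemma Rintegral_rho_expansion n :
  \int[mu]_(x in `]pi / 6, pi / 2]) rho n (2 * sin x) =
  \sum_(0 <= k < n.+1) 'C(n, k)%:R *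
    \int[mu]_(x in `]pi / 6, pi / 2])
      (ln (2 * sin x) ^+ (n - k) * rho k (2 * sin x)^-1).
Proof.
have mI : measurable (`]pi / 6, pi / 2] : set (measurableTypeR R)) by exact: measurable_itv.
have iI k : mu.-integrable `]pi / 6, pi / 2]
    (EFin \o (fun x => ln (2 * sin x) ^+ (n - k) * rho k (2 * sin x)^-1)).
  apply: integrableS (integrable_ln_rho (n - k) k); [exact: measurable_itv|exact: mI|].
  by apply: subset_itvr; rewrite bnd_simp.
transitivity (\int[mu]_(x in `]pi / 6, pi / 2])
    \sum_(0 <= k < n.+1) 'C(n, k)%:R *
      (ln (2 * sin x) ^+ (n - k) * rho k (2 * sin x)^-1)).
  apply: eq_Rintegral => x; rewrite inE/= in_itv/= => xI.
  by rewrite rho_gt1// twosin_gt1.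
rewrite Rintegral_sum//; last by move=> k; exact: (integrableZl mI 'C(n, k)%:R (iI k)).
by apply: eq_bigr => k _; rewrite RintegralZl.
Qed.

End mahler.

Theorem theorem7 (R : realType) (n : nat) (hn : (1 <= n)%N) :
  mahler_1xy R n =
    pi^-1 * (Ls n.+1 (pi / 3) - Ls n.+1 pi)
    + 2 / pi * \int[lebesgue_measure]_(theta in `[0, pi / 6]) rho n (2 * sin theta)
    + 2 / pi * \sum_(2 <= k < n.+1) 'C(n, k)%:R *
        \int[lebesgue_measure]_(theta in `[pi / 6, pi / 2])
          (ln (2 * sin theta) ^+ (n - k) * rho k (2 * sin theta)^-1).
Proof.
have p0 := @pi_gt0 R.
have h26 : pi / 6 <= pi / 2 :> R by lra.
have h06 : 0 <= pi / 6 :> R by lra.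
have split6 := @Rintegral_itvB R _ _ _ (pi / 6) (integrable_rho_2sin n 0 (pi / 2))
  ltac:(by rewrite bnd_simp) ltac:(by rewrite bnd_simp).
move/eqP: split6; rewrite subr_eq => /eqP split6.
rewrite mahler_1xy_rho split6 Rintegral_rho_expansion Ls_sub_pi.
(* The terms k = 0 and k = 1 are peeled off; [hn] guarantees the second. The latter vanishes because
   1/(2 sin x) < 1 on the open side of pi/6. *)
rewrite big_ltn// big_ltn// bin0 subn0 mul1r.
rewrite [X in 'C(n, 1)%:R * X](_ : _ = 0); last first.
  rewrite (@eq_Rintegral _ _ _ _ _ (fun=> 0)).
    by rewrite Rintegral_cst ?mul0r//; exact: measurable_itv.
  move=> x; rewrite inE/= in_itv/= => /twosin_gt1 x1.
  rewrite rho1_eq0 ?mulr0//; apply/andP; split.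
    by rewrite invr_ge0 ltW// (lt_trans ltr01).
  by rewrite invf_lt1// (lt_trans ltr01).
rewrite mulr0 add0r.
(* Adding the null endpoint pi/6 gives the closed interval of the statement. *)
have -> : \sum_(2 <= k < n.+1) 'C(n, k)%:R *
      \int[lebesgue_measure]_(x in `]pi / 6, pi / 2])
        (ln (2 * sin x) ^+ (n - k) * rho k (2 * sin x)^-1) =
    \sum_(2 <= k < n.+1) 'C(n, k)%:R *
      \int[lebesgue_measure]_(x in `[pi / 6, pi / 2])
        (ln (2 * sin x) ^+ (n - k) * rho k (2 * sin x)^-1) :> R.
  apply: eq_bigr => k _; congr (_ * _); apply: Rintegral_itv_obnd_cbnd.
  apply: integrableS (integrable_ln_rho (n - k) k);
    [exact: measurable_itv|exact: measurable_itv|].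
  by apply: subset_itvr; rewrite bnd_simp.
(* The k = 0 term, where rho_0 = 1, is the log-sine difference of [Ls_sub_pi]. *)
have -> : \int[lebesgue_measure]_(x in `]pi / 6, pi / 2])
      (ln (2 * sin x) ^+ n * rho 0 (2 * sin x)^-1) =
    \int[lebesgue_measure]_(x in `]pi / 6, pi / 2]) ln (2 * sin x) ^+ n :> R.
  by apply: eq_Rintegral => x _; rewrite rho0 mulr1.
set S := (X in _ = _ + 2 / pi * X); set A := Rintegral _ _ _; set B := Rintegral _ _ _.
rewrite mulrDr addrAC mulrDr; congr (_ + _ + _).
by rewrite mulrA (mulrC pi^-1).
Qed.
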